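(* Suppose $0<\lambda<1$, $0\leq s<\epsilon<1$, and $0<\delta\leq 1/2$. Put $\nu=1-\lambda$. If the positive integer $N$ (the number of tests) satisfies $$N\geq\frac{\epsilon}{[\lambda\nu(\epsilon-s)]^2}\left(\ln\delta^{-1}+4\lambda\nu^2\right),$$ then $\bar{\epsilon}_{\lambda}(\lfloor\nu sN\rfloor,N,\delta)\leq\epsilon$.
   Context: Target state. Let $d$ be a prime, $n\ge 1$, $\mathcal{H}=(\mathbb{C}^d)^{\otimes n}$, $\omega=e^{2\pi \mathrm{i}/d}$, and let $Z|j\rangle=\omega^j|j\rangle$ for $j\in\mathbb{Z}_d$. Given a graph with vertex set $\{1,\dots,n\}$, edge set $E$ (edges join distinct vertices) and multiplicities $m_e\in\mathbb{Z}_d$ for $e\in E$, the qudit graph state is $|G\rangle=\big(\prod_{e\in E}\mathrm{CZ}_e^{m_e}\big)|+\rangle^{\otimes n}\in\mathcal{H}$, where $|+\rangle=d^{-1/2}\sum_{j\in\mathbb{Z}_d}|j\rangle$ and $\mathrm{CZ}_{(i,j)}=\sum_{k\in\mathbb{Z}_d}|k\rangle\langle k|_i\otimes Z_j^k$. Strategy. For a parameter $\lambda$ put $\nu=1-\lambda$, $\Omega=|G\rangle\langle G|+\lambda(\mathbb{1}-|G\rangle\langle G|)$ and $\overline{\Omega}=\mathbb{1}-\Omega$. Guaranteed infidelity. For integers $0\leq k\leq N-1$ and a permutation-invariant density operator $\rho$ on $\mathcal{H}^{\otimes(N+1)}$ (i.e. invariant under conjugation by all permutations of the $N+1$ tensor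 factors), let $$p_k(\rho)=\sum_{i=0}^k\binom{N}{i}\operatorname{tr}\big([\Omega^{\otimes(N-i)}\otimes\overline{\Omega}^{\otimes i}\otimes\mathbb{1}]\rho\big),\qquad f_k(\rho)=\sum_{i=0}^k\binom{N}{i}\operatorname{tr}\big([\Omega^{\otimes(N-i)}\otimes\overline{\Omega}^{\otimes i}\otimes|G\rangle\langle G|]\rho\big),$$ and $F_k(\rho)=f_k(\rho)/p_k(\rho)$ when $p_k(\rho)>0$. For $0<\delta\leq 1$ define $$\bar{\epsilon}_{\lambda}(k,N,\delta)=1-\min_{\rho}\{F_k(\rho)\mid p_k(\rho)\geq\delta\},$$ the minimum being over permutation-invariant density operators $\rho$ on $\mathcal{H}^{\otimes(N+1)}$. *)

(* Defs.v *)
From HB Require Import structures.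
From mathcomp Require Import all_boot all_order all_algebra.
From mathcomp Require Import perm complex.
From mathcomp Require Import boolp classical_sets reals exp trigo.

Set Implicit Arguments.
Unset Strict Implicit.
Unset Printing Implicit Defensive.

Import Order.TTheory GRing.Theory Num.Theory.

Local Open Scope ring_scope.
Local Open Scope complex_scope.
Local Open Scope sesquilinear_scope.
Local Open Scope classical_set_scope.

(* The computational basis of the I-fold tensor power of C^q is
   {ffun I -> 'I_q}: the matrix index a stands for the basis vector
   \otimes_i |label a i>. *)
Definition tdim (I : finType) (q : nat) : nat := #|{ffun I -> 'I_q}|.

Definition label (I : finType) (q : nat) (a : 'I_(tdim I q)) :
    {ffun I -> 'I_q} :=
  enum_val a.

Definition tensor_vec (R : realType) (I : finType) (q : nat)
    (v : I -> 'cV[R[i]]_q) : 'cV[R[i]]_(tdim I q) :=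
  \col_a \prod_(i : I) v i (label a i) 0.

Definition tensor_op (R : realType) (I : finType) (q : nat)
    (A : I -> 'M[R[i]]_q) : 'M[R[i]]_(tdim I q) :=
  \matrix_(a, b) \prod_(i : I) A i (label a i) (label b i).

Definition local_op (R : realType) (I : finType) (q : nat) (j : I)
    (A : 'M[R[i]]_q) : 'M[R[i]]_(tdim I q) :=
  tensor_op (fun i => if i == j then A else 1%:M).

Definition omega (R : realType) (d : nat) : R[i] :=
  cos (2 * pi / d%:R) +i* sin (2 * pi / d%:R).

(* Elements of Z_d are represented by 'I_d; they only ever occur as basis
   labels or as exponents of operators of order dividing d. *)
Definition Zgate (R : realType) (d : nat) : 'M[R[i]]_d :=
  diag_mx (\row_(j < d) omega R d ^+ j).

Definition plus_state (R : realType) (d : nat) : 'cV[R[i]]_d :=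
  const_mx (Num.sqrt d%:R)^-1%:C.

Definition CZ (R : realType) (d n : nat) (e : 'I_n * 'I_n) :
    'M[R[i]]_(tdim 'I_n d) :=
  \sum_(k < d)
    local_op e.1 (delta_mx k k) *m local_op e.2 (Zgate R d ^+ k).

(* An edge {i, j} is encoded as the pair (i, j) with i < j; since the gate CZ
   is symmetric in i and j, the choice of orientation is immaterial. *)
Definition edge_set (n : nat) (E : {set 'I_n * 'I_n}) : Prop :=
  forall e, e \in E -> (e.1 < e.2)%N.

Definition graph_state (R : realType) (d n : nat) (E : {set 'I_n * 'I_n})
    (m : 'I_n * 'I_n -> 'I_d) : 'cV[R[i]]_(tdim 'I_n d) :=
  (\prod_(e in E) CZ R d e ^+ m e) *m tensor_vec (fun=> plus_state R d).

Definition ketbra (R : realType) (q : nat) (v : 'cV[R[i]]_q) : 'M[R[i]]_q :=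
  v *m v^t*.

Definition Omega (R : realType) (q : nat) (G : 'cV[R[i]]_q) (lambda : R) :
    'M[R[i]]_q :=
  ketbra G + lambda%:C *: (1%:M - ketbra G).

Definition psd (R : realType) (q : nat) (A : 'M[R[i]]_q) : Prop :=
  A \is hermsymmx /\ forall v : 'cV[R[i]]_q, 0 <= (v^t* *m A *m v) 0 0.

Definition density (R : realType) (q : nat) (rho : 'M[R[i]]_q) : Prop :=
  psd rho /\ \tr rho = 1.

Definition perm_op (R : realType) (I : finType) (q : nat) (sigma : {perm I}) :
    'M[R[i]]_(tdim I q) :=
  \matrix_(a, b) (label a == [ffun i => label b (sigma i)])%:R.

Definition perm_invariant (R : realType) (I : finType) (q : nat)
    (rho : 'M[R[i]]_(tdim I q)) : Prop :=
  forall sigma : {perm I},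
    perm_op R q sigma *m rho *m (perm_op R q sigma)^t* = rho.

(* Omega on the first N - i factors, 1 - Omega on the next i factors and X on
   the last factor. *)
Definition test_op (R : realType) (q : nat) (G : 'cV[R[i]]_q) (lambda : R)
    (N i : nat) (X : 'M[R[i]]_q) : 'M[R[i]]_(tdim 'I_N.+1 q) :=
  tensor_op (fun j : 'I_N.+1 =>
    if (j < N - i)%N then Omega G lambda
    else if (j < N)%N then 1%:M - Omega G lambda
    else X).

(* The sums below are real whenever rho is Hermitian and 0 <= lambda <= 1, so
   that taking real parts only changes their type. *)
Definition pass_prob (R : realType) (q : nat) (G : 'cV[R[i]]_q) (lambda : R)
    (k N : nat) (rho : 'M[R[i]]_(tdim 'I_N.+1 q)) : R :=
  complex.Re (\sum_(i < k.+1)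
    'C(N, i)%:R * \tr (test_op G lambda N i 1%:M *m rho)).

Definition pass_fid (R : realType) (q : nat) (G : 'cV[R[i]]_q) (lambda : R)
    (k N : nat) (rho : 'M[R[i]]_(tdim 'I_N.+1 q)) : R :=
  complex.Re (\sum_(i < k.+1)
    'C(N, i)%:R * \tr (test_op G lambda N i (ketbra G) *m rho)).

Definition cond_fid (R : realType) (q : nat) (G : 'cV[R[i]]_q) (lambda : R)
    (k N : nat) (rho : 'M[R[i]]_(tdim 'I_N.+1 q)) : R :=
  pass_fid G lambda k rho / pass_prob G lambda k rho.

Definition feasible_fids (R : realType) (q : nat) (G : 'cV[R[i]]_q)
    (lambda : R) (k N : nat) (delta : R) : set R :=
  [set F | exists rho : 'M[R[i]]_(tdim 'I_N.+1 q),
     [/\ density rho, perm_invariant rho,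
         delta <= pass_prob G lambda k rho & F = cond_fid G lambda k rho]].

(* The default 0, taken when S has no minimum, makes an upper bound below 1 on
   guaranteed_infidelity entail that the minimum is attained. *)
Definition minimum (R : realType) (S : set R) : R := xget 0 (S `&` lbound S).

Definition guaranteed_infidelity (R : realType) (q : nat) (G : 'cV[R[i]]_q)
    (lambda : R) (k N : nat) (delta : R) : R :=
  1 - minimum (feasible_fids G lambda k N delta).

(* Main.v *)
(* Write P = |G><G| and Q = 1 - P. By permutation invariance only the weights
   v_S = tr(T_S rho) matter, where T_S is the tensor product of Q over S and P off
   S; they form an exchangeable probability distribution on sets S of "bad"
   systems, a bad system failing its test with probability nu independently.
   Averaging over the position of the untested system, the inequality
   (1 - eta) p - f <= (eps - eta) delta, from which p >= delta gives
   f >= (1 - eps) p, reduces to one inequality for each j = #|S| about partial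
   sums of the binomial law Bin(j, nu). The identity
   lam j b_(j-1)(i) = (j - i) b_j(i) turns it into a bound on a truncated first
   moment, which Chernoff's method together with Hoeffding's lemma provides
   uniformly in j; eta = s + 3/4 (eps - s) is good enough.
   The minimum is attained because the feasible states form a compact set. *)
Require Import Defs.
From HB Require Import structures.
From mathcomp Require Import all_boot all_order all_algebra.
From mathcomp Require Import perm complex ring lra.
From mathcomp Require Import all_classical all_reals all_analysis.
From mathcomp Require Import fintype finset.
Import Order.TTheory GRing.Theory Num.Theory.
Import numFieldNormedType.Exports.
Local Open Scope ring_scope.

(** * Binomial tails *)

(** Hoeffding's lemma for a Bernoulli variable. The gap [g] between the logarithms of the two sides
    and its derivative [h] both vanish at 0, and the derivative of [h] is 1/4 minus the variance of
    a tilted Bernoulli law. *)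
Lemma bernoulli_mgf_le {R : realType} (lam nu t : R) :
  0 < lam -> 0 <= nu -> lam + nu = 1 -> 0 <= t ->
  lam + nu * expR (- t) <= expR (t ^+ 2 / 8 - nu * t).
Proof.
move=> lam0 nu0 lamnu t0.
pose w (x : R) := lam + nu * expR (- x).
have w0 x : 0 < w x by rewrite ltr_wpDr// mulr_ge0// expR_ge0.
have dw x : is_derive x (1 : R) w (- (nu * expR (- x))).
  have dexp := @is_derive1_comp R (@expR R) -%R x _ _
    (is_derive_expR _) (is_deriveNid _ _).
  have dmul : is_derive x (1 : R) (fun x => nu * expR (- x))
      (- (nu * expR (- x))).
    by apply: is_derive_eq; rewrite /GRing.scale/=; ring.
  by apply: is_derive_eq; rewrite /GRing.scale/=; ring.
have dwV x : is_derive x (1 : R) (fun x => (w x)^-1)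
    (nu * expR (- x) / w x ^+ 2).
  apply: is_derive_eq; first by apply: is_deriveV; rewrite gt_eqF.
  by rewrite /GRing.scale/=; field; rewrite gt_eqF.
(* The derivative of [g], with [nu * expR (- x) / w x] written as [1 - lam / w x] so that only the
   inverse of [w] remains to be differentiated. *)
pose h (x : R) := x / 4 - nu + 1 - lam * (w x)^-1.
have dh x : is_derive x (1 : R) h
    (1 / 4 - lam * (nu * expR (- x) / w x ^+ 2)).
  rewrite /h; apply: is_derive_eq.
  by rewrite /GRing.scale/=; ring.
pose g (x : R) := x ^+ 2 / 8 - nu * x - ln (w x).
have dg x : is_derive x (1 : R) g (h x).
  have dl : is_derive x (1 : R) (fun x => ln (w x))
      (- (nu * expR (- x)) / w x).
    have H := @is_derive1_comp R (@ln R) w x _ _ (is_derive1_ln (w0 x)) (dw x).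
    by apply: is_derive_eq; rewrite /GRing.scale/= mulrC.
  have dsq : is_derive x (1 : R) (fun x => x ^+ 2 / 8) (x / 4).
    rewrite (_ : (fun x => _) = 8^-1 *: (id ^+ 2)); last first.
      by apply/funext => y; rewrite /GRing.scale/= mulrC.
    by apply: is_derive_eq; rewrite /GRing.scale/= expr1; field.
  rewrite /g; apply: is_derive_eq.
  rewrite /h /GRing.scale/=.
  have -> : nu * expR (- x) = w x - lam by rewrite /w; ring.
  by field; rewrite gt_eqF.
have mvt (f df : R -> R) (x : R) : (forall x, is_derive x (1:R) f (df x)) ->
    (forall x, 0 <= x -> 0 <= df x) -> 0 <= x -> f 0 <= f x.
  move=> fdf df0; rewrite le_eqVlt => /orP[/eqP<-//|x0].
  have fcont : {within `[0, x], continuous f}%classic.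
    apply: continuous_subspaceT => y.
    by apply: differentiable_continuous; apply/derivable1_diffP; case: (fdf y).
  have [c] := MVT x0 (fun y _ => fdf y) fcont.
  rewrite in_itv/= => /andP[c0 _] fE.
  by rewrite -subr_ge0 fE subr0; apply: mulr_ge0 (ltW x0); exact: df0 (ltW c0).
have wE0 : w 0 = 1 by rewrite /w oppr0 expR0 mulr1.
have h0 x : 0 <= x -> 0 <= h x.
  move=> x0; have <- : h 0 = 0 by rewrite /h wE0 invr1; lra.
  apply: mvt x0 => // y _.
  have -> : 1 / 4 - lam * (nu * expR (- y) / w y ^+ 2) =
      (lam - nu * expR (- y)) ^+ 2 / (4 * w y ^+ 2).
    have -> : nu * expR (- y) = w y - lam by rewrite /w; ring.
    by field; rewrite gt_eqF.
  by rewrite divr_ge0 ?sqr_ge0// mulr_ge0// sqr_ge0.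
have := mvt g h t dg h0 t0.
rewrite {1}/g wE0 ln1 expr2 !mulr0 mul0r !subr0 /g subr_ge0 => lnw.
by rewrite -[leLHS]lnK ?posrE ?w0// ler_expR.
Qed.

Definition bin_pmf {R : realType} (lam nu : R) (j i : nat) : R :=
  'C(j, i)%:R * nu ^+ i * lam ^+ (j - i).

Definition bin_cdf {R : realType} (lam nu : R) (j k : nat) : R :=
  \sum_(i < k.+1) bin_pmf lam nu j i.

(** Expresses the law for one bad system fewer through the law for [j], so that sums over both can
    be merged; it rests on [j C(j-1, i) = (j - i) C(j, i)]. *)
Lemma bin_pmf_pred {R : realType} (lam nu : R) (j i : nat) :
  lam * (j%:R * bin_pmf lam nu j.-1 i) = (j%:R - i%:R) * bin_pmf lam nu j i.
Proof.
rewrite /bin_pmf; have [ji|ij] := ltnP j i.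
  by rewrite !bin_small ?(leq_ltn_trans (leq_pred j))// !mul0r !mulr0.
have binE : (j%:R - i%:R) * 'C(j, i)%:R = j%:R * 'C(j.-1, i)%:R :> R.
  by rewrite -natrB// -!natrM mul_bin_down.
rewrite !mulrA binE.
case: j ij {binE} => [|j] ij; first by rewrite !(mul0r, mulr0).
have [ji|{}ij] := ltnP j i; first by rewrite bin_small// !(mul0r, mulr0).
by rewrite subSn// exprS /=; ring.
Qed.

Lemma bin_pmf_ge0 {R : realType} (lam nu : R) (j i : nat) :
  0 <= lam -> 0 <= nu -> 0 <= bin_pmf lam nu j i.
Proof. by move=> l0 n0; rewrite /bin_pmf !mulr_ge0// exprn_ge0. Qed.

Lemma bin_pmf_mgf_le {R : realType} (lam nu t : R) (j k : nat) :
  0 <= lam -> 0 <= nu ->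
  \sum_(i < k.+1) bin_pmf lam nu j i * expR (- t * i%:R) <=
  (lam + nu * expR (- t)) ^+ j.
Proof.
move=> lam0 nu0.
pose F i := bin_pmf lam nu j i * expR (- t * i%:R).
have F0 i : 0 <= F i by rewrite mulr_ge0 ?bin_pmf_ge0// expR_ge0.
(* No order between [k] and [j] is known, so the partial sum and the full binomial expansion are
   both embedded in a sum of length [k + j + 1]; terms beyond [j] vanish. *)
have -> : (lam + nu * expR (- t)) ^+ j = \sum_(i < (k + j).+1) F i.
  rewrite exprDn (big_ord_widen (k + j).+1 (fun i : nat =>
    (lam ^+ (j - i) * (nu * expR (- t)) ^+ i) *+ 'C(j, i))) ?ltnS ?leq_addl//.
  rewrite big_mkcond; apply: eq_bigr => i _; rewrite ltnS /F /bin_pmf.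
  case: leqP => [ij|ji]; last by rewrite bin_small// !mul0r.
  by rewrite -mulr_natl exprMn -expRM_natr; ring.
rewrite (big_ord_widen (k + j).+1 F) ?ltnS ?leq_addr//.
by rewrite big_mkcond ler_sum// => i _; case: ifP.
Qed.

(* The bracket is [lam^-1] times the sum of [a i * bin_pmf lam nu j i] with [a]
   affine, and [e * y <= exp y] at [y = tau * a i] makes Chernoff's method apply.
   With [tau (1 - nu eta)] below the cumulant of the binomial law, the
   exponents of the two factors cancel and the bound is uniform in [j]. *)
Lemma bin_excess_le {R : realType} (lam nu eta tau t M : R) (j k : nat) :
  0 < lam -> 0 <= nu -> lam + nu = 1 -> 0 < tau -> tau * (1 - eta) <= t ->
  lam + nu * expR (- t) <= expR (- (tau * (1 - nu * eta))) ->
  expR 1 * tau * lam *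
    (j%:R * (1 - eta) * bin_cdf lam nu j.-1 k
     - eta * (M - j%:R) * bin_cdf lam nu j k) <=
  expR ((t - tau * (1 - eta)) * k%:R - tau * eta * lam * M).
Proof.
move=> lam0 nu0 lamnu tau0 taut mgf.
pose a (i : nat) := j%:R * (1 - nu * eta) - (1 - eta) * i%:R - eta * lam * M.
have -> : expR 1 * tau * lam *
    (j%:R * (1 - eta) * bin_cdf lam nu j.-1 k
     - eta * (M - j%:R) * bin_cdf lam nu j k) =
    \sum_(i < k.+1) expR 1 * (tau * a i) * bin_pmf lam nu j i.
  transitivity (expR 1 * tau * ((1 - eta) *
      (\sum_(i < k.+1) lam * (j%:R * bin_pmf lam nu j.-1 i)) -
    lam * eta * (M - j%:R) * (\sum_(i < k.+1) bin_pmf lam nu j i))).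
    by rewrite -!mulr_sumr /bin_cdf; ring.
  rewrite !mulr_sumr -sumrB mulr_sumr; apply: eq_bigr => i _.
  rewrite bin_pmf_pred /a (_ : nu = 1 - lam); last by rewrite -lamnu; ring.
  by ring.
(* For [i <= k] one has [tau * a i <= c - t * i], the slack being [(t - tau * (1 - eta)) * (k - i)],
   nonnegative by [taut]. *)
pose c := j%:R * (tau * (1 - nu * eta)) + ((t - tau * (1 - eta)) * k%:R
  - tau * eta * lam * M).
apply: (@le_trans _ _ (\sum_(i < k.+1)
    expR c * (bin_pmf lam nu j i * expR (- t * i%:R)))).
  apply: ler_sum => i _.
  rewrite [leRHS]mulrCA [leLHS]mulrC ler_wpM2l ?bin_pmf_ge0 ?(ltW lam0)//.
  apply: (@le_trans _ _ (expR (tau * a i))).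
    have -> : expR (tau * a i) = expR 1 * expR (tau * a i - 1).
      by rewrite -expRD; congr expR; ring.
    rewrite ler_wpM2l ?expR_ge0//.
    by apply: le_trans (expR_ge1Dx _); rewrite addrC subrK.
  rewrite -expRD ler_expR /a /c.
  have ik : (i%:R : R) <= k%:R by rewrite ler_nat -ltnS.
  have : 0 <= (t - tau * (1 - eta)) * (k%:R - i%:R).
    by rewrite mulr_ge0// subr_ge0.
  by lra.
rewrite -mulr_sumr.
apply: (@le_trans _ _ (expR c * expR (- (tau * (1 - nu * eta))) ^+ j)).
  rewrite ler_wpM2l ?expR_ge0//.
  apply: le_trans (bin_pmf_mgf_le _ _ _ _ _ (ltW lam0) nu0) _.
  rewrite lerXn2r// nnegrE ?expR_ge0//.
  by rewrite (addr_ge0 (ltW lam0))// (mulr_ge0 nu0)// expR_ge0.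
rewrite -expRM_natr -expRD ler_expR /c; lra.
Qed.

Lemma expR1_ge {R : realType} : 51 / 20 <= expR (1 : R).
Proof.
have -> : (1 : R) = 8^-1 * 8%:R by field.
rewrite expRM_natr; apply: (@le_trans _ _ ((9 / 8) ^+ 8 : R)).
  by rewrite !exprS expr0; lra.
rewrite lerXn2r ?nnegrE ?expR_ge0//.
by apply: le_trans (expR_ge1Dx _); lra.
Qed.

(** Equivalent to [exp (-2/3) >= 1/2]; already [(17/18)^12] lies just above 1/2. *)
Lemma ln2_ge {R : realType} : 2 / 3 <= ln (2 : R).
Proof.
rewrite -[leLHS]expRK ler_ln ?posrE ?expR_gt0//.
rewrite -[leRHS]invrK -[leLHS]invrK lef_pV2 ?posrE ?invr_gt0 ?expR_gt0//.
have -> : (expR (2 / 3 : R))^-1 = expR (- 18^-1) ^+ 12.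
  by rewrite -expRN -expRM_natr; congr expR; field.
apply: (@le_trans _ _ ((17 / 18) ^+ 12 : R)).
  by rewrite !exprS expr0; lra.
rewrite lerXn2r ?nnegrE ?expR_ge0//.
by apply: le_trans (expR_ge1Dx _); lra.
Qed.

(** The surplus exponent outweighs the prefactor left by Chernoff's method. The worst case is
    [x = 2/3]; there [exp z >= 1 + z] leaves a polynomial in [y], smallest at [y = 1], with value
    about 1.013. *)
Lemma expR_prefactor_ge1 {R : realType} (x y : R) :
  2 / 3 <= x -> 0 <= y <= 1 ->
  1 <= expR 1 * (3 / 4) * (1 - 3 / 8 * y) * x *
       expR (x * (1 / 8 + 9 / 32 * y)).
Proof.
move=> x23 /andP[y0 y1].
have e1 := @expR1_ge R.
have ez : 1 + 2 / 3 * (1 / 8 + 9 / 32 * y) <=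
    expR (x * (1 / 8 + 9 / 32 * y)).
  apply: le_trans (expR_ge1Dx _).
  by rewrite lerD2l ler_wpM2r//; lra.
apply: (@le_trans _ _ (51 / 20 * (3 / 4) * (1 - 3 / 8 * y) * (2 / 3) *
  (1 + 2 / 3 * (1 / 8 + 9 / 32 * y)))); first by nra.
have a0 : 0 <= 1 - 3 / 8 * y by lra.
have c0 : 0 <= 51 / 20 * (3 / 4) * (1 - 3 / 8 * y) by rewrite mulr_ge0.
apply: ler_pM; [by rewrite mulr_ge0|by lra| |exact: ez].
apply: ler_pM => //; rewrite ler_wpM2r// ler_wpM2r//.
Qed.

(** The inequality for [j] bad systems among [N + 1]. The exponent supplied by [bin_excess_le] is at
    most [- x - x * (1/8 + 9/32 y)]: the first part yields [delta], the rest pays for the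
    prefactor. *)
Lemma bin_excess_bound {R : realType} (lam nu s eps delta eta : R) (N k j : nat) :
  0 < lam < 1 -> nu = 1 - lam -> 0 <= s -> s < eps -> eps < 1 ->
  0 < delta <= 2^-1 -> (0 < N)%N ->
  eps / (lam * nu * (eps - s)) ^+ 2 * (ln (delta^-1) + 4 * lam * nu ^+ 2)
    <= N%:R ->
  k%:R <= nu * s * N%:R ->
  eta = eps - (eps - s) / 4 ->
  j%:R * (1 - eta) * bin_cdf lam nu j.-1 k
    - eta * (N.+1%:R - j%:R) * bin_cdf lam nu j k
  <= N.+1%:R * (eps - eta) * delta.
Proof.
move=> /andP[lam0 lam1] nuE s0 seps eps1 /andP[d0 d12] N0 hN hk etaE.
have nu0 : 0 < nu by lra.
have nu1 : nu < 1 by lra.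
have eps0 : 0 < eps by lra.
have D0 : 0 < eps - s by lra.
(* In terms of [y], the hypothesis on [N] reads [N nu^2 y^2 eps >= ln (1/delta) + 4 lam nu^2]. *)
pose y := lam * (eps - s) / eps.
have yeps : y * eps = lam * (eps - s) by rewrite /y divfK ?gt_eqF.
have yE : y = lam * (eps - s) / eps by [].
have y0 : 0 < y by rewrite divr_gt0// mulr_gt0.
have y1 : y <= 1 by rewrite ler_pdivrMr//; nra.
move: y yE yeps y0 y1 => y yE yeps y0 y1.
have eta0 : 0 <= eta by rewrite etaE; lra.
have etaeps : eta < eps by rewrite etaE; lra.
have nueta : 0 < 1 - nu * eta by nra.
(* The optimal Chernoff exponent at [eta] would be [4 nu Delta / theta] with
   [theta] as below and [Delta = theta - s]; [t] replaces [Delta] and [theta] by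
   their bounds [3/4 lam (eps - s)] and [eps]. *)
pose t := 3 * nu * y.
have t0 : 0 < t by rewrite /t !mulr_gt0.
pose psi := nu * t - t ^+ 2 / 8.
have psiE : psi = 3 * nu ^+ 2 * y * (1 - 3 / 8 * y).
  by rewrite /psi /t; field.
have psi0 : 0 < psi by rewrite psiE; do 3?[apply: mulr_gt0]; rewrite ?exprn_gt0//; lra.
(* Chosen so that the cumulant condition of [bin_excess_le] becomes Hoeffding's lemma at [t], whose
   exponent is [psi]. *)
pose tau := psi / (1 - nu * eta).
have tauE : tau * (1 - nu * eta) = psi by rewrite divfK ?gt_eqF.
have tau0 : 0 < tau by rewrite divr_gt0.
have psi_tau : psi <= tau by rewrite -tauE ler_piMr ?(ltW tau0)//; nra.
have taut : tau * (1 - eta) <= t.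
  have : tau * (1 - eta) <= tau * (1 - nu * eta).
    by rewrite ler_pM2l//; nra.
  rewrite tauE => /le_trans; apply; rewrite /psi.
  have : nu * t <= t by rewrite ler_piMl ?ltW.
  by have := sqr_ge0 t; lra.
have mgf : lam + nu * expR (- t) <= expR (- (tau * (1 - nu * eta))).
  rewrite tauE /psi opprB; apply: bernoulli_mgf_le => //; rewrite ?ltW//.
  by rewrite nuE; ring.
have corr0 : 0 <= 4 * lam * nu ^+ 2.
  by apply: mulr_ge0 (sqr_ge0 nu); rewrite mulr_ge0// ltW.
pose x := N%:R * (nu ^+ 2 * y ^+ 2 * eps).
have xE : ln delta^-1 + 4 * lam * nu ^+ 2 <= x.
  have q0 : 0 < nu ^+ 2 * y ^+ 2 * eps by rewrite !mulr_gt0 ?exprn_gt0.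
  rewrite -ler_pdivrMr//; apply: le_trans hN; rewrite mulrC ler_wpM2r//.
    by rewrite addr_ge0// ln_ge0// invf_ge1//; lra.
  rewrite le_eqVlt; apply/orP; left; apply/eqP.
  by rewrite yE; field; rewrite !gt_eqF.
have lnx : ln delta^-1 <= x.
  by apply: le_trans xE; rewrite lerDl.
(* Here [delta <= 1/2] enters: it keeps [x] above [ln 2]. *)
have x23 : 2 / 3 <= x.
  apply: le_trans (le_trans ln2_ge _) lnx.
  rewrite ler_ln ?posrE ?invr_gt0//.
  by rewrite -[leLHS]invrK lef_pV2 ?posrE ?invr_gt0.
have expx : expR (- x) <= delta.
  rewrite -[leRHS]lnK ?posrE// ler_expR -lerN2 opprK.
  by rewrite -lnV ?posrE// .
have c0 : 0 < expR 1 * tau * lam by exact: mulr_gt0 (mulr_gt0 (expR_gt0 1) tau0) lam0.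
rewrite -(ler_pM2l c0).
have lamnu : lam + nu = 1 by rewrite nuE; ring.
apply: le_trans (@bin_excess_le R _ _ _ _ _ _ j k lam0 (ltW nu0) lamnu
  tau0 taut mgf) _.
(* Defined so that at [k = nu s N] the exponent per test is [nu s t - psi theta]; see [tauth]. *)
pose theta := s + lam * (eta - s) / (1 - nu * eta).
have eta_s : 0 <= eta - s by rewrite etaE; lra.
have theta_ge : s + lam * (eta - s) <= theta.
  rewrite lerD2l ler_pdivlMr// ler_piMr ?mulr_ge0 ?(ltW lam0)//.
  by nra.
have theta_le : theta <= eta.
  rewrite -lerBrDl ler_pdivrMr// mulrC ler_wpM2l//; nra.
have tauth : tau * (nu * s * (1 - eta) + eta * lam) = psi * theta.
  by rewrite /tau /theta nuE; field; rewrite -nuE gt_eqF.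
(* [psi theta] is [t nu theta - t^2 theta / 8]: the lower bound on [theta] serves the first term,
   the upper bound the second. *)
have rate : nu * s * t - psi * theta <=
    - (nu ^+ 2 * y ^+ 2 * eps * (9 / 8 + 9 / 32 * y)).
  have h1 : t * nu * (s + lam * (eta - s)) <= t * nu * theta.
    by rewrite (ler_pM2l (mulr_gt0 t0 nu0)).
  have h2 : t ^+ 2 / 8 * theta <= t ^+ 2 / 8 * (eps * (1 - y / 4)).
    rewrite ler_pM2l ?divr_gt0 ?exprn_gt0//.
    apply: (le_trans theta_le); rewrite etaE.
    have -> : eps * (1 - y / 4) = eps - lam * (eps - s) / 4.
      by rewrite -yeps; ring.
    by nra.
  have h3 : t * nu * (lam * (eta - s)) = 9 / 4 * (nu ^+ 2 * y ^+ 2 * eps).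
    have -> : lam * (eta - s) = 3 / 4 * (y * eps).
      by rewrite yeps etaE; field.
    by rewrite /t; field.
  have h4 : t ^+ 2 / 8 * (eps * (1 - y / 4)) =
      nu ^+ 2 * y ^+ 2 * eps * (9 / 8 * (1 - y / 4)).
    by rewrite /t; field.
  rewrite h4 in h2; rewrite mulrDr h3 in h1; rewrite /psi; lra.
(* Replacing [N + 1] by [N] drops the term [- tau * eta * lam], which is at most 0. *)
have expo : (t - tau * (1 - eta)) * k%:R - tau * eta * lam * N.+1%:R <=
    - x - x * (1 / 8 + 9 / 32 * y).
  have N1 : (0 : R) < N%:R by rewrite ltr0n.
  have h1 : (t - tau * (1 - eta)) * k%:R <=
      (t - tau * (1 - eta)) * (nu * s * N%:R).
    by rewrite ler_wpM2l// subr_ge0.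
  have h2 := mulr_ge0 (mulr_ge0 (ltW tau0) eta0) (ltW lam0).
  have : N%:R * (nu * s * t - psi * theta) <=
    N%:R * - (nu ^+ 2 * y ^+ 2 * eps * (9 / 8 + 9 / 32 * y)).
    by rewrite ler_pM2l.
  rewrite -tauth /x -natr1 => h3; lra.
apply: (@le_trans _ _ (expR (- x) * expR (- (x * (1 / 8 + 9 / 32 * y))))).
  by rewrite -expRD ler_expR.
rewrite mulrA (mulrC _ delta); apply: ler_pM; rewrite ?expR_ge0//.
have y01 : 0 <= y <= 1 by rewrite ltW.
have ez0 := expR_gt0 (x * (1 / 8 + 9 / 32 * y)).
rewrite expRN -[leLHS]mul1r ler_pdivrMr//.
apply: le_trans (expR_prefactor_ge1 _ _ x23 y01) _.
rewrite ler_pM2r//.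
(* Since [y * eps = lam * (eps - s)] and [eps - eta = (eps - s) / 4], the two prefactors differ only
   by [psi <= tau] and [N <= N + 1]. *)
have -> : expR 1 * (3 / 4) * (1 - 3 / 8 * y) * x =
  expR 1 * lam * (psi * (N%:R * ((eps - s) / 4))).
  transitivity (expR 1 * (psi * (N%:R * (y * eps / 4)))).
    by rewrite psiE /x; field.
  by rewrite yeps; field.
have -> : expR 1 * tau * lam * (N.+1%:R * (eps - eta)) =
  expR 1 * lam * (tau * (N.+1%:R * ((eps - s) / 4))).
  by rewrite etaE; field.
rewrite ler_pM2l ?mulr_gt0 ?expR_gt0//.
apply: ler_pM; rewrite ?(ltW psi0)// ?mulr_ge0 ?divr_ge0 ?(ltW D0)//.
by rewrite ler_wpM2r ?divr_ge0 ?(ltW D0)// ler_nat.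
Qed.

(** * Exchangeable sets of bad systems *)

(** Swapping an element of [S1 :\: S2] with one of [S2 :\: S1] brings [S1] closer to [S2]; induction
    on the size of [S1 :\: S2]. *)
Lemma tperm_invariant_card {I : finType} {T : Type} (A : {set I})
    (g : {set I} -> T) :
  (forall a b (S : {set I}), a \in A -> b \in A -> g (tperm a b @: S) = g S) ->
  forall S1 S2 : {set I}, S1 \subset A -> S2 \subset A -> #|S1| = #|S2| ->
  g S1 = g S2.
Proof.
move=> gA S1 S2; move: {2}#|S1 :\: S2| (leqnn #|S1 :\: S2|) => n.
elim: n S1 => [|n IHn] S1.
  rewrite leqn0 cards_eq0 setD_eq0 => S12 _ _ eqS; congr g.
  by apply/eqP; rewrite eqEcard S12 eqS leqnn.
move=> leS sS1 sS2 eqS.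
have [S12|/set0Pn[a]] := eqVneq (S1 :\: S2) set0.
  by apply: IHn => //; rewrite S12 cards0.
rewrite inE => /andP[aS2 aS1].
have /set0Pn[b] : S2 :\: S1 != set0.
  rewrite -cards_eq0; have := cardsID S1 S2; have := cardsID S2 S1.
  rewrite -eqS setIC => <- /addnI ->; rewrite cards_eq0; apply/set0Pn.
  by exists a; rewrite inE aS2.
rewrite inE => /andP[bS1 bS2].
have aA := subsetP sS1 a aS1; have bA := subsetP sS2 b bS2.
rewrite -(gA a b S1 aA bA); apply: IHn => //.
- have sub : tperm a b @: S1 :\: S2 \subset (S1 :\: S2) :\ a.
    apply/subsetP => x; rewrite !inE => /andP[xS2 /imsetP[y yS1 xE]].
    move: xS2; rewrite {}xE; case: tpermP => [_|yb|ya yb].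
    - by rewrite bS2.
    - by move: bS1; rewrite -yb yS1.
    - by move=> yS2; rewrite yS1 yS2 (introN eqP ya).
  apply: leq_trans (subset_leq_card sub) _.
  by move: leS; rewrite (cardsD1 a (S1 :\: S2)) inE aS2 aS1.
- apply/subsetP => _ /imsetP[y yS1 ->].
  by case: tpermP => // _ _; exact: (subsetP sS1).
- by rewrite card_imset//; exact: perm_inj.
Qed.

(* The weight of the outcome "exactly the tests in F fail" when the tested
   systems in S are orthogonal to the target and the others are in it. *)
Definition fail_weight {R : realType} (lam nu : R) {I : finType} (l : I)
    (F S : {set I}) : R :=
  \prod_(j | j != l)
    (if j \in S then if j \in F then nu else lam else (j \notin F)%:R).

Lemma fail_weight_perm {R : realType} (lam nu : R) (I : finType) (l : I)
    (s : {perm I}) (F S : {set I}) : s l = l ->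
  fail_weight lam nu l (s @: F) (s @: S) = fail_weight lam nu l F S.
Proof.
move=> sl; rewrite /fail_weight (reindex_inj (@perm_inj _ s)) /=.
apply: eq_big => [j|j _]; first by rewrite -{1}sl (inj_eq perm_inj).
by rewrite !mem_imset//; exact: perm_inj.
Qed.

(** A good system never fails its test, so only sets [F] of tested bad systems have nonzero
    weight. *)
Lemma fail_weightE {R : realType} (lam nu : R) (I : finType) (l : I)
    (F S : {set I}) : l \notin F ->
  fail_weight lam nu l F S =
  (F \subset S :\ l)%:R * (nu ^+ #|F| * lam ^+ (#|S :\ l| - #|F|)).
Proof.
move=> lF; have [FS|] := boolP (F \subset S :\ l); last first.
  case/subsetPn => x xF; rewrite !inE negb_and negbK => xS; rewrite mul0r.
  have xl : x != l by apply: contraNneq lF => <-.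
  move: xS; rewrite (negPf xl)/= => xS.
  by rewrite /fail_weight (bigD1 x)//= (negPf xS) xF mul0r.
rewrite mul1r -!prodr_const.
have -> : \prod_(i in F) nu = \prod_(j | j != l) if j \in F then nu else 1.
  rewrite -big_mkcondr/=; apply: eq_bigl => j.
  by rewrite andb_idl// => jF; apply: contraNneq lF => <-.
have -> : lam ^+ (#|S :\ l| - #|F|) =
    \prod_(j | j != l) if j \in (S :\ l) :\: F then lam else 1.
  rewrite -big_mkcondr/= -cardsDS// -prodr_const; apply: eq_bigl => j.
  by rewrite andb_idl// !inE => /and3P[].
rewrite -big_split/=; apply: eq_bigr => j jl; rewrite !inE jl.
have [jF|jF] := boolP (j \in F); last by case: ifP; rewrite mul1r.
by have := subsetP FS j jF; rewrite !inE jl/= => ->; rewrite mulr1.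
Qed.

(** The tested bad systems fail independently, so the number of failures follows a binomial law. *)
Lemma sum_fail_weight {R : realType} (lam nu : R) (I : finType) (l : I)
    (S : {set I}) (i : nat) :
  \sum_(F : {set I} | (F \subset [set~ l]) && (#|F| == i))
    fail_weight lam nu l F S = bin_pmf lam nu #|S :\ l| i.
Proof.
pose D := [set F : {set I} | (F \subset S :\ l) && (#|F| == i)].
transitivity (\sum_(F in D) nu ^+ i * lam ^+ (#|S :\ l| - i)).
  rewrite [RHS]big_mkcond [LHS]big_mkcond/=; apply: eq_bigr => F _.
  rewrite inE; have [/eqP Fi|] := boolP (#|F| == i); last by rewrite !andbF.
  rewrite !andbT; case: ifP => [Fl|]; last first.
    case: ifP => // FS; move/negP; case; apply: subset_trans FS _.
    by apply/subsetP => x; rewrite !inE => /andP[].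
  have lF : l \notin F.
    by apply/negP => /(subsetP Fl); rewrite !inE eqxx.
  rewrite fail_weightE// Fi.
  by case: ifP; rewrite ?mul1r ?mul0r.
by rewrite sumr_const cards_draws -mulr_natl mulrA.
Qed.

Section exchangeable.
Context {R : realType} (lam nu : R) (I : finType) (l : I).
Variable v : {set I} -> R.
Hypothesis v_perm : forall (s : {perm I}) (S : {set I}), v (s @: S) = v S.

(** By exchangeability every failure set of the same size contributes equally. The binomial
    coefficient therefore turns one prescribed set into the sum over all of them, to which
    [sum_fail_weight] applies. *)
Lemma exchangeable_test (h : bool -> R) (F : {set I}) : l \notin F ->
  'C(#|I|.-1, #|F|)%:R *
    \sum_(S : {set I}) h (l \in S) * fail_weight lam nu l F S * v S =
  \sum_(S : {set I}) h (l \in S) * bin_pmf lam nu #|S :\ l| #|F| * v S.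
Proof.
move=> lF.
pose W (F : {set I}) :=
  \sum_(S : {set I}) h (l \in S) * fail_weight lam nu l F S * v S.
have W_perm a b (G : {set I}) : a \in [set~ l] -> b \in [set~ l] ->
    W (tperm a b @: G) = W G.
  rewrite !inE => al bl; have sl : tperm a b l = l by rewrite tpermD.
  rewrite {1}/W (reindex_inj (imset_inj (@perm_inj _ (tperm a b))))/=.
  apply: eq_bigr => S _; rewrite fail_weight_perm// v_perm.
  by rewrite -{1}sl mem_imset//; exact: perm_inj.
have sF : F \subset [set~ l].
  by apply/subsetP => x xF; rewrite !inE; apply: contraNneq lF => <-.
transitivity (\sum_(G : {set I} | (G \subset [set~ l]) && (#|G| == #|F|)) W G).
  have WE (G : {set I}) :
      (G \subset [set~ l]) && (#|G| == #|F|) -> W G = W F.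
    by case/andP=> sG /eqP eqG; exact: (tperm_invariant_card _ W W_perm).
  rewrite (eq_bigr _ WE) sumr_const -[in RHS]mulr_natl; congr (_ * _).
  by rewrite -(cardsC1 l) -cards_draws cardsE.
rewrite /W exchange_big/=; apply: eq_bigr => S _.
by rewrite -sum_fail_weight mulr_sumr mulr_suml.
Qed.

(** The sum is the same whichever system [m] is left untested. Adding over all [m], a given [S] is
    met [#|S|] times with [m] bad and otherwise with [m] good. For empty [S] the term with [#|S|.-1]
    has coefficient 0. *)
Lemma exchangeable_average (h : bool -> R) (B : nat -> R) :
  #|I|%:R * \sum_(S : {set I}) h (l \in S) * B #|S :\ l| * v S =
  \sum_(S : {set I}) (#|S|%:R * h true * B #|S|.-1 +
    (#|I|%:R - #|S|%:R) * h false * B #|S|) * v S.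
Proof.
transitivity (\sum_(m : I) \sum_(S : {set I}) h (m \in S) * B #|S :\ m| * v S).
  rewrite mulr_natl -sumr_const; apply: eq_bigr => m _.
  rewrite (reindex_inj (imset_inj (@perm_inj _ (tperm l m))))/=.
  apply: eq_bigr => S _; rewrite v_perm.
  have inj := @perm_inj _ (tperm l m).
  have memE : (l \in tperm l m @: S) = (m \in S).
    by rewrite -{1}(tpermR l m) mem_imset.
  have := cardsD1 l (tperm l m @: S); rewrite card_imset// memE.
  by rewrite (cardsD1 m S) => /addnI ->.
rewrite exchange_big/=; apply: eq_bigr => S _; rewrite -mulr_suml; congr (_ * _).
rewrite (bigID (mem S))/=; congr (_ + _).
  rewrite (eq_bigr (fun=> h true * B #|S|.-1)); last first.
    by move=> m mS; rewrite mS (cardsD1 m S) mS.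
  by rewrite sumr_const -[LHS]mulr_natl mulrA.
rewrite (eq_bigr (fun=> h false * B #|S|)); last first.
  by move=> m mS; rewrite (negPf mS) [#|S|](cardsD1 m S) (negPf mS).
rewrite sumr_const -[LHS]mulr_natl mulrA; congr (_ * _ * _).
rewrite -natrB ?max_card//; congr (_%:R).
by rewrite -(cardsC S) addKn; apply: eq_card => x; rewrite !inE.
Qed.

End exchangeable.

(** * Tensor products *)

Local Open Scope complex_scope.
Local Open Scope sesquilinear_scope.

Lemma adjmxM {C : numClosedFieldType} (m n p : nat)
    (A : 'M[C]_(m, n)) (B : 'M[C]_(n, p)) :
  (A *m B)^t* = B^t* *m A^t*.
Proof. by rewrite trmx_mul map_mxM. Qed.

Lemma adjmxK {C : numClosedFieldType} (m n : nat) (A : 'M[C]_(m, n)) :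
  (A^t*)^t* = A.
Proof. by apply/matrixP => i j; rewrite !mxE conjCK. Qed.

Lemma adjmxB {C : numClosedFieldType} (m n : nat) (A B : 'M[C]_(m, n)) :
  (A - B)^t* = A^t* - B^t*.
Proof. by apply/matrixP => i j; rewrite !mxE rmorphB. Qed.

Lemma adjmx1 {C : numClosedFieldType} (n : nat) :
  (1%:M : 'M[C]_n)^t* = 1%:M.
Proof. by rewrite trmx1 map_mx1. Qed.

Lemma hermsymmxP {C : numClosedFieldType} (n : nat) (A : 'M[C]_n) :
  reflect (A^t* = A) (A \is hermsymmx).
Proof.
apply: (iffP (is_hermitianmxP _ _ _)) => [{2}->|AE].
  by rewrite expr0 scale1r.
by rewrite expr0 scale1r AE.
Qed.

Lemma normsq_mx_ge0 {C : numClosedFieldType} (n : nat) (u : 'cV[C]_n) :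
  0 <= (u^t* *m u) 0 0.
Proof.
by rewrite mxE sumr_ge0// => i _; rewrite !mxE mulrC -normCK exprn_ge0.
Qed.

Section tensor.
Context {R : realType} (I : finType) (q : nat).
Implicit Types (A B : I -> 'M[R[i]]_q) (a b : 'I_(tdim I q)).

Lemma sum_label (V : zmodType) (F : {ffun I -> 'I_q} -> V) :
  \sum_(a < tdim I q) F (label a) = \sum_f F f.
Proof.
by rewrite [RHS](reindex (@label I q)); last exact/onW_bij/enum_val_bij.
Qed.

Lemma label_inj : injective (@label I q).
Proof. exact: enum_val_inj. Qed.

Lemma labelE a b : (label a == label b) = (a == b).
Proof. exact: inj_eq label_inj _ _. Qed.

Lemma label_onto (f : {ffun I -> 'I_q}) : exists a, label a = f.
Proof. by exists (enum_rank f); rewrite /label enum_rankK. Qed.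

Lemma tensor_opM A B :
  tensor_op A *m tensor_op B = tensor_op (fun i => A i *m B i).
Proof.
apply/matrixP => a b; rewrite !mxE.
pose F i x := A i (label a i) x * B i x (label b i).
transitivity (\sum_(c < tdim I q) \prod_i F i (label c i)).
  by apply: eq_bigr => c _; rewrite !mxE -big_split.
rewrite (sum_label _ (fun f => \prod_i F i (f i))) -bigA_distr_bigA.
by apply: eq_bigr => i _; rewrite mxE.
Qed.

Lemma mxtrace_tensor_op A : \tr (tensor_op A) = \prod_i \tr (A i).
Proof.
rewrite /mxtrace bigA_distr_bigA.
rewrite -(sum_label _ (fun f => \prod_i A i (f i) (f i))).
by apply: eq_bigr => a _; rewrite mxE.
Qed.

Lemma adj_tensor_op A : (tensor_op A)^t* = tensor_op (fun i => (A i)^t*).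
Proof.
apply/matrixP => a b; rewrite !mxE rmorph_prod.
by apply: eq_bigr => i _; rewrite !mxE.
Qed.

Lemma eq_tensor_op A B : A =1 B -> tensor_op A = tensor_op B.
Proof. by move=> /funext->. Qed.

Lemma tensor_op_diag (d : I -> 'rV[R[i]]_q) :
  tensor_op (fun i => diag_mx (d i)) =
  diag_mx (\row_a \prod_i d i 0 (label a i)).
Proof.
apply/matrixP => a b; rewrite !mxE.
have [->|ab] := eqVneq a b.
  by rewrite mulr1n; apply: eq_bigr => i _; rewrite !mxE eqxx mulr1n.
rewrite mulr0n; move: ab; rewrite -labelE => /eqP/ffunP/boolp.existsNP[i /eqP ne].
by rewrite (bigD1 i)//= !mxE (negPf ne) mulr0n mul0r.
Qed.

Lemma tensor_op1 : tensor_op (fun=> 1%:M) = 1%:M :> 'M[R[i]]_(tdim I q).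
Proof.
rewrite -diag_const_mx tensor_op_diag; apply/matrixP => a b.
by rewrite !mxE big1// => i _; rewrite mxE.
Qed.

(** Distributivity: [S] collects the factors from which [Q] is taken. *)
Lemma tensor_op_comb (c d : I -> R[i]) (P Q : 'M[R[i]]_q) :
  tensor_op (fun i => c i *: P + d i *: Q) =
  \sum_(S : {set I}) (\prod_i (if i \in S then d i else c i)) *:
    tensor_op (fun i => if i \in S then Q else P).
Proof.
apply/matrixP => a b; rewrite summxE !mxE.
transitivity (\prod_i (d i * Q (label a i) (label b i) +
  c i * P (label a i) (label b i))).
  by apply: eq_bigr => i _; rewrite !mxE addrC.
rewrite bigA_distr; apply: eq_bigr => S _; rewrite !mxE -big_split/=.
by apply: eq_bigr => i _; case: ifP.
Qed.

Lemma perm_op_adj (s : {perm I}) :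
  (perm_op R q s)^t* = perm_op R q s^-1%g.
Proof.
apply/matrixP => a b; rewrite !mxE rmorph_nat; congr (_%:R).
congr nat_of_bool; apply/eqP/eqP => ->; apply/ffunP => i; rewrite !ffunE.
  by rewrite permKV.
by rewrite permK.
Qed.

Lemma perm_op_conj (s : {perm I}) A :
  perm_op R q s *m tensor_op A *m (perm_op R q s)^t* =
  tensor_op (fun i => A (s i)).
Proof.
apply/matrixP => a b; rewrite !mxE.
have [a' a'E] := label_onto [ffun i => label a ((s^-1)%g i)].
have [b' b'E] := label_onto [ffun i => label b ((s^-1)%g i)].
have sE (x y y' : 'I_(tdim I q)) :
    label y' = [ffun i => label x ((s^-1)%g i)] ->
    (label x == [ffun i => label y (s i)]) = (y == y').
  move=> y'E; rewrite -[RHS]labelE y'E.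
  apply/eqP/eqP => ->; apply/ffunP => i; rewrite !ffunE ?permKV//.
  by rewrite permK.
rewrite (bigD1 b')//= big1 ?addr0; last first.
  move=> c cb; rewrite !mxE (sE _ _ _ b'E) (negPf cb) rmorph0 mulr0//.
rewrite !mxE (sE _ _ _ b'E) eqxx rmorph1 mulr1.
rewrite (bigD1 a')//= big1 ?addr0; last first.
  by move=> c ca; rewrite !mxE (sE _ _ _ a'E) (negPf ca) mul0r.
rewrite !mxE (sE _ _ _ a'E) eqxx mul1r a'E b'E.
rewrite (reindex_inj (@perm_inj _ s)).
by apply: eq_bigr => i _; rewrite !ffunE permK.
Qed.

(** Cyclicity of the trace moves the permutation from the operator to the state, which absorbs
    it. *)
Lemma mxtrace_perm_invariant (rho : 'M[R[i]]_(tdim I q)) (s : {perm I}) A :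
  perm_invariant rho ->
  \tr (tensor_op (fun i => A (s i)) *m rho) = \tr (tensor_op A *m rho).
Proof.
move=> rhoP; rewrite -perm_op_conj -[in RHS](rhoP s^-1%g) perm_op_adj.
by rewrite !mulmxA [RHS]mxtrace_mulC perm_op_adj invgK !mulmxA.
Qed.

(** The trace equals that of [T rho T], whose diagonal entries are values of the form of [rho] at
    the columns of [T]. *)
Lemma mxtrace_proj_ge0 (m : nat) (T rho : 'M[R[i]]_m) :
  T^t* = T -> T *m T = T -> psd rho -> 0 <= \tr (T *m rho).
Proof.
move=> Tadj TT [_ rho0].
rewrite -TT -mulmxA mxtrace_mulC; apply: sumr_ge0 => a _.
have -> : (T *m rho *m T) a a = ((col a T)^t* *m rho *m col a T) 0 0.
  rewrite tr_col map_row Tadj -row_mul !mxE.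
  by apply: eq_bigr => j _; rewrite !mxE.
exact: rho0.
Qed.

End tensor.

(** * Test probabilities *)

Lemma ReD {R : rcfType} (x y : R[i]) :
  complex.Re (x + y) = complex.Re x + complex.Re y.
Proof. by case: x; case: y. Qed.

Lemma Re_sum {R : rcfType} (J : Type) (r : seq J) (D : pred J)
    (F : J -> R[i]) :
  complex.Re (\sum_(j <- r | D j) F j) =
  \sum_(j <- r | D j) complex.Re (F j).
Proof. exact: (big_morph (@complex.Re R) ReD). Qed.

Lemma Re_realM {R : rcfType} (x : R) (z : R[i]) :
  complex.Re (x%:C * z) = x * complex.Re z.
Proof. by case: z => a b /=; rewrite mul0r subr0. Qed.

Section target.
Context {R : realType} {q : nat} (G : 'cV[R[i]]_q).
Hypothesis G1 : G^t* *m G = 1%:M.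

Lemma ketbra_adj : (ketbra G)^t* = ketbra G.
Proof. by rewrite adjmxM adjmxK. Qed.

Lemma ketbraM : ketbra G *m ketbra G = ketbra G.
Proof. by rewrite /ketbra mulmxA -(mulmxA G) G1 mulmx1. Qed.

Lemma ketbraC_adj : (1%:M - ketbra G)^t* = 1%:M - ketbra G.
Proof. by rewrite adjmxB adjmx1 ketbra_adj. Qed.

Lemma ketbraCM :
  (1%:M - ketbra G) *m (1%:M - ketbra G) = 1%:M - ketbra G.
Proof.
by rewrite mulmxBl mul1mx mulmxBr mulmx1 ketbraM subrr subr0.
Qed.

Lemma mxtrace_ketbra : \tr (ketbra G) = 1.
Proof. by rewrite /ketbra mxtrace_mulC G1 mxtrace1. Qed.

(** The projector onto the states whose bad systems are exactly those in [S]. *)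
Definition sector_op {I : finType} (S : {set I}) : 'M[R[i]]_(tdim I q) :=
  tensor_op (fun j => if j \in S then 1%:M - ketbra G else ketbra G).

Lemma sector_op_adj {I : finType} (S : {set I}) :
  (sector_op S)^t* = sector_op S.
Proof.
rewrite adj_tensor_op; apply: eq_tensor_op => j.
by case: ifP; rewrite ?ketbra_adj ?ketbraC_adj.
Qed.

Lemma sector_opM {I : finType} (S : {set I}) :
  sector_op S *m sector_op S = sector_op S.
Proof.
rewrite tensor_opM; apply: eq_tensor_op => j.
by case: ifP; rewrite ?ketbraM ?ketbraCM.
Qed.

Lemma sum_sector_op (I : finType) : \sum_(S : {set I}) sector_op S = 1%:M.
Proof.
rewrite -tensor_op1 (@eq_tensor_op _ _ _ _
  (fun=> 1 *: ketbra G + 1 *: (1%:M - ketbra G))); last first.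
  by move=> j; rewrite !scale1r addrC subrK.
rewrite tensor_op_comb; apply: eq_bigr => S _.
by rewrite big1 ?scale1r// => i _; case: ifP.
Qed.

Definition sector_prob {I : finType} (rho : 'M[R[i]]_(tdim I q))
    (S : {set I}) : R :=
  complex.Re (\tr (sector_op S *m rho)).

Lemma sector_prob_ge0 {I : finType} (rho : 'M[R[i]]_(tdim I q))
    (S : {set I}) : psd rho -> 0 <= sector_prob rho S.
Proof.
move=> rho0.
have := mxtrace_proj_ge0 _ _ rho (sector_op_adj S) (sector_opM S) rho0.
by rewrite /sector_prob; case: (\tr _) => a b; rewrite lecE/= => /andP[].
Qed.

Lemma sum_sector_prob {I : finType} (rho : 'M[R[i]]_(tdim I q)) :
  \tr rho = 1 -> \sum_(S : {set I}) sector_prob rho S = 1.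
Proof.
move=> tr1; rewrite /sector_prob -Re_sum.
have -> : \sum_(S : {set I}) \tr (sector_op S *m rho) = \tr rho.
  by rewrite -[in RHS](mul1mx rho) -sum_sector_op mulmx_suml raddf_sum.
by rewrite tr1.
Qed.

Lemma sector_prob_perm {I : finType} (rho : 'M[R[i]]_(tdim I q))
    (s : {perm I}) (S : {set I}) : perm_invariant rho ->
  sector_prob rho (s @: S) = sector_prob rho S.
Proof.
move=> rhoP; rewrite /sector_prob -(mxtrace_perm_invariant _ _ _ s)//.
congr (complex.Re (\tr (_ *m _))); apply: eq_tensor_op => j.
by rewrite mem_imset//; exact: perm_inj.
Qed.

Variables (lam nu : R) (N : nat).
Hypothesis nuE : nu = 1 - lam.
Variable rho : 'M[R[i]]_(tdim 'I_N.+1 q).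

(** The positions where [test_op] puts [1 - Omega]; [ord_max] is the untested system. *)
Let late (i : nat) : {set 'I_N.+1} := [set j : 'I_N.+1 | (N - i <= j < N)%N].

Let card_late (i : nat) : (i <= N)%N -> #|late i| = i.
Proof.
move=> iN; rewrite -sum1_card.
transitivity (\sum_(j < N.+1 | (N - i <= j)%N && (j < N)%N) 1)%N.
  by apply: eq_bigl => j; rewrite inE.
rewrite -(big_ord_widen_cond N.+1 (fun j => N - i <= j)%N (fun=> 1%N))//.
transitivity (\sum_(N - i <= j < N) 1)%N; first by rewrite big_geq_mkord.
by rewrite sum_nat_const_nat muln1 subKn.
Qed.

Let ord_max_late (i : nat) : ord_max \notin late i.
Proof. by rewrite inE ltnn andbF. Qed.

(** [Omega] is [P + lam Q] and its complement is [nu Q], so expanding the tensor product produces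
    the failure weights. The pair [(c, d)] covers both observables on the last factor: [(1, 1)] is
    the identity and [(1, 0)] the target projector. *)
Lemma Re_test_op (i : nat) (c d : R) :
  complex.Re (\tr (test_op G lam N i
    (c%:C *: ketbra G + d%:C *: (1%:M - ketbra G)) *m rho)) =
  \sum_(S : {set 'I_N.+1}) (if ord_max \in S then d else c) *
    fail_weight lam nu ord_max (late i) S * sector_prob rho S.
Proof.
pose cP (j : 'I_N.+1) : R :=
  if j == ord_max then c else (j \notin late i)%:R.
pose cQ (j : 'I_N.+1) : R :=
  if j == ord_max then d else if j \in late i then nu else lam.
have -> : test_op G lam N i (c%:C *: ketbra G + d%:C *: (1%:M - ketbra G)) =
    tensor_op (fun j => (cP j)%:C *: ketbra G + (cQ j)%:C *: (1%:M - ketbra G)).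
  apply: eq_tensor_op => j; rewrite /cP /cQ inE.
  have [->|jN] := eqVneq j ord_max.
    by rewrite ltnn ltnNge leq_subr.
  have jN' : (j < N)%N.
    by rewrite ltn_neqAle -ltnS ltn_ord andbT; apply: contraNneq jN => jE;
      apply/eqP/val_inj.
  rewrite jN' andbT ltnNge; case: leqP => _ /=.
    by rewrite scale0r add0r nuE rmorphB rmorph1 scalerBl scale1r /Omega opprD addrA.
  by rewrite scale1r.
rewrite tensor_op_comb mulmx_suml.
rewrite (@raddf_sum _ _ (@mxtrace R[i] (tdim 'I_N.+1 q))) Re_sum.
apply: eq_bigr => S _; rewrite /= -scalemxAl mxtraceZ.
have -> : \prod_j (if j \in S then (cQ j)%:C else (cP j)%:C) =
    (\prod_j (if j \in S then cQ j else cP j))%:C :> R[i].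
  by rewrite rmorph_prod; apply: eq_bigr => j _; case: ifP.
rewrite Re_realM; congr (_ * _).
rewrite (bigD1 ord_max)//= /cP /cQ eqxx; congr (_ * _).
by apply: eq_bigr => j /negPf->.
Qed.

Lemma Re_sum_test_op (k : nat) (c d : R) : perm_invariant rho ->
  complex.Re (\sum_(i < k.+1) 'C(N, i)%:R * \tr (test_op G lam N i
    (c%:C *: ketbra G + d%:C *: (1%:M - ketbra G)) *m rho)) =
  \sum_(S : {set 'I_N.+1}) (if ord_max \in S then d else c) *
    bin_cdf lam nu #|S :\ ord_max| k * sector_prob rho S.
Proof.
move=> rhoP; rewrite Re_sum.
transitivity (\sum_(i < k.+1) \sum_(S : {set 'I_N.+1})
  (if ord_max \in S then d else c) *
    bin_pmf lam nu #|S :\ ord_max| i * sector_prob rho S).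
  apply: eq_bigr => i _.
  rewrite -(rmorph_nat (real_complex R)) Re_realM Re_test_op.
  have [iN|Ni] := leqP i N.
    have /= := @exchangeable_test R lam nu _ ord_max _
      (fun s S => sector_prob_perm rho s S rhoP)
      (fun b => if b then d else c) _ (ord_max_late i).
    by rewrite card_ord card_late.
  (* For [i > N] both sides vanish: at most [N] tested systems can be bad. *)
  rewrite bin_small// mul0r big1// => S _.
  have : (#|S :\ ord_max| <= N)%N.
    rewrite -ltnS -[X in (_ < X)%N]card_ord -cardsT.
    by apply: proper_card; apply/properP; split; [exact: subsetT|];
      exists ord_max; rewrite !inE ?eqxx.
  by move=> /leq_ltn_trans/(_ Ni)/bin_small; rewrite /bin_pmf => ->;
    rewrite !(mul0r, mulr0).
rewrite exchange_big/=; apply: eq_bigr => S _.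
by rewrite -mulr_suml -mulr_sumr.
Qed.

Lemma pass_probE (k : nat) : perm_invariant rho ->
  pass_prob G lam k rho =
  \sum_(S : {set 'I_N.+1})
    bin_cdf lam nu #|S :\ ord_max| k * sector_prob rho S.
Proof.
move=> rhoP; have := Re_sum_test_op k 1 1 rhoP.
rewrite rmorph1 !scale1r addrC subrK /pass_prob => ->.
by apply: eq_bigr => S _; case: ifP; rewrite mul1r.
Qed.

Lemma pass_fidE (k : nat) : perm_invariant rho ->
  pass_fid G lam k rho =
  \sum_(S : {set 'I_N.+1}) (ord_max \notin S)%:R *
    bin_cdf lam nu #|S :\ ord_max| k * sector_prob rho S.
Proof.
move=> rhoP; have := Re_sum_test_op k 1 0 rhoP.
rewrite rmorph1 rmorph0 scale1r scale0r addr0 /pass_fid => ->.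
by apply: eq_bigr => S _; case: (ord_max \in S).
Qed.

Lemma cond_fid_ge (s eps delta : R) (k : nat) :
  0 < lam < 1 -> 0 <= s -> s < eps -> eps < 1 -> 0 < delta <= 2^-1 ->
  (0 < N)%N ->
  eps / (lam * nu * (eps - s)) ^+ 2 * (ln (delta^-1) + 4 * lam * nu ^+ 2)
    <= N%:R ->
  k%:R <= nu * s * N%:R ->
  density rho -> perm_invariant rho -> delta <= pass_prob G lam k rho ->
  1 - eps <= cond_fid G lam k rho.
Proof.
move=> hlam s0 seps eps1 hdelta N0 hN hk [rho0 tr1] rhoP dp.
have d0 : 0 < delta by case/andP: hdelta.
have p0 := lt_le_trans d0 dp.
rewrite /cond_fid ler_pdivlMr//.
pose eta := eps - (eps - s) / 4.
have eta_lt : eta < eps by rewrite /eta; lra.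
have le_eps : (1 - eta) * pass_prob G lam k rho - pass_fid G lam k rho <=
    (eps - eta) * delta.
  (* The coefficient in [(1 - eta) p - f]: [1 - eta] if the untested system is bad, [- eta] if it is
     good. *)
  pose h (b : bool) : R := b%:R - eta.
  have -> : (1 - eta) * pass_prob G lam k rho - pass_fid G lam k rho =
      \sum_(S : {set 'I_N.+1}) h (ord_max \in S) *
        bin_cdf lam nu #|S :\ ord_max| k * sector_prob rho S.
    rewrite pass_probE// pass_fidE// mulr_sumr -sumrB; apply: eq_bigr => S _.
    by rewrite /h; case: (ord_max \in S) => /=; ring.
  have N1 : (0 : R) < N.+1%:R by rewrite ltr0n.
  rewrite -(ler_pM2l N1).
  have /= := @exchangeable_average R _ ord_max _
      (fun s S => sector_prob_perm rho s S rhoP) h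
      (fun j => bin_cdf lam nu j k).
  rewrite card_ord => ->.
  (* The sector probabilities sum to 1, so the constant is spread over the sectors and the
     comparison is made termwise. *)
  have -> : N.+1%:R * ((eps - eta) * delta) = \sum_(S : {set 'I_N.+1})
      N.+1%:R * ((eps - eta) * delta) * sector_prob rho S.
    by rewrite -mulr_sumr sum_sector_prob// mulr1.
  apply: ler_sum => S _; rewrite ler_wpM2r ?sector_prob_ge0//.
  have := @bin_excess_bound R lam nu s eps delta eta N k #|S|
    hlam nuE s0 seps eps1 hdelta N0 hN hk erefl.
  by rewrite /h /= -/eta; lra.
have : (eps - eta) * delta <= (eps - eta) * pass_prob G lam k rho.
  by rewrite ler_pM2l// subr_gt0.
lra.
Qed.

End target.

(** * Graph states *)

Lemma norm_omega {R : realType} (d : nat) : `|omega R d| = 1.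
Proof. by rewrite /omega normc_def cos2Dsin2 sqrtr1. Qed.

Lemma local_op_diag {R : realType} {I : finType} (q : nat) (j : I)
    (d : 'rV[R[i]]_q) :
  local_op j (diag_mx d) = diag_mx (\row_a d 0 (label a j)).
Proof.
rewrite /local_op (@eq_tensor_op R I q _
  (fun i => diag_mx (if i == j then d else const_mx 1))); last first.
  by move=> i; case: eqP => // _; rewrite diag_const_mx.
rewrite tensor_op_diag; congr diag_mx; apply/rowP => a; rewrite !mxE.
rewrite (bigD1 j)//= eqxx big1 ?mulr1// => i /negPf->.
by rewrite mxE.
Qed.

Lemma ZgateX {R : realType} (d k : nat) :
  Zgate R d ^+ k = diag_mx (\row_(j < d) omega R d ^+ (k * j)).
Proof.
elim: k => [|k IHk].
  by apply/matrixP => x y; rewrite expr0 -[1]/(1%:M) !mxE mul0n.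
rewrite exprS IHk [LHS]mulmx_diag; congr diag_mx; apply/rowP => j.
by rewrite !mxE -exprD mulSn.
Qed.

Lemma delta_mx_diag {F : nzSemiRingType} (q : nat) (k : 'I_q) :
  delta_mx k k = diag_mx (delta_mx 0 k) :> 'M[F]_q.
Proof.
apply/matrixP => x y; rewrite !mxE eqxx /=.
have [<-|xy] := eqVneq x y; first by rewrite andbb mulr1n.
by rewrite mulr0n; case: eqVneq => //= xk; rewrite -xk eq_sym (negPf xy).
Qed.

(** In row [a] only the term [k = label a e.1] of the sum survives. Unitarity follows, since the
    diagonal entries are powers of a number of modulus 1. *)
Lemma CZ_diag {R : realType} (d n : nat) (e : 'I_n * 'I_n) :
  CZ R d e = diag_mx (\row_a omega R d ^+ (label a e.1 * label a e.2)).
Proof.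
apply/matrixP => a b; rewrite summxE (bigD1 (label a e.1))//= big1 ?addr0.
  by rewrite delta_mx_diag ZgateX !local_op_diag mulmx_diag !mxE !eqxx mul1r.
move=> k ka.
rewrite delta_mx_diag ZgateX !local_op_diag mulmx_diag !mxE eqxx eq_sym (negPf ka).
by rewrite mul0r mul0rn.
Qed.

Lemma CZ_unitary {R : realType} (d n : nat) (e : 'I_n * 'I_n) :
  (CZ R d e)^t* *m CZ R d e = 1%:M.
Proof.
rewrite CZ_diag tr_diag_mx map_diag_mx mulmx_diag -diag_const_mx.
congr diag_mx; apply/rowP => a; rewrite !mxE.
by rewrite -normCKC normrX norm_omega !expr1n.
Qed.

Lemma tensor_plus_unit {R : realType} (I : finType) (d : nat) : (0 < d)%N ->
  (tensor_vec (fun=> plus_state R d) : 'cV_(tdim I d))^t* *m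
    tensor_vec (fun=> plus_state R d) = 1%:M.
Proof.
move=> d0; apply/matrixP => x y; rewrite !ord1 !mxE.
have dR : (0 : R) <= d%:R by rewrite ler0n.
transitivity (\sum_(a < tdim I d) ((d%:R^-1 : R)%:C) ^+ #|I|).
  apply: eq_bigr => a _; rewrite !mxE -normCKC normr_prod.
  under eq_bigr do rewrite mxE.
  rewrite prodr_const cardT -cardE -exprM mulnC exprM.
  rewrite normc_def/= expr0n/= addr0 sqrtr_sqr -rmorphXn/= real_normK ?num_real//.
  by rewrite exprVn sqr_sqrtr.
rewrite sumr_const card_ord /tdim card_ffun card_ord -[LHS]mulr_natl -rmorphXn/=.
rewrite -[X in X * _](rmorph_nat (real_complex R)) -rmorphM/= natrX exprVn divff ?eqxx//.
by rewrite expf_neq0// pnatr_eq0 -lt0n.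
Qed.

(** Supplies the normalisation [G1]: the gates are unitary and the product of plus states is a unit
    vector. *)
Lemma graph_state_unit {R : realType} (d n : nat) (E : {set 'I_n * 'I_n})
    (m : 'I_n * 'I_n -> 'I_d) : (0 < d)%N ->
  (graph_state R E m)^t* *m graph_state R E m = 1%:M.
Proof.
move=> d0; rewrite /graph_state.
set U := \prod_(e in E) _.
have UU : U^t* *m U = 1%:M.
  have unitM (A B : 'M[R[i]]_(tdim 'I_n d)) :
      A^t* *m A = 1%:M -> B^t* *m B = 1%:M -> (A *m B)^t* *m (A *m B) = 1%:M.
    by move=> A1 B1; rewrite adjmxM mulmxA -(mulmxA _ _ A) A1 mulmx1.
  apply: (big_ind (fun A : 'M[R[i]]_(tdim 'I_n d) => A^t* *m A = 1%:M)) => //.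
    by rewrite adjmx1 mulmx1.
  move=> e _; elim: (nat_of_ord (m e)) => [|k IHk].
    by rewrite expr0 adjmx1 mulmx1.
  by rewrite exprS; apply: unitM => //; exact: CZ_unitary.
by rewrite adjmxM mulmxA -(mulmxA _ _ U) UU mulmx1 tensor_plus_unit.
Qed.

(** * Existence of the minimum *)

Lemma scalar_continuous {R : realType} (n : nat) (L : 'rV[R]_n -> R) :
  scalar L -> continuous L.
Proof.
move=> Llin.
pose L' : {scalar 'rV[R]_n} :=
  HB.pack L (GRing.isLinear.Build _ _ _ *%R L Llin).
have -> : L = fun x => \sum_j x 0 j * L (delta_mx 0 j).
  apply/funext => x; rewrite [in LHS](row_sum_delta x).
  rewrite (_ : L = L')// linear_sum; apply: eq_bigr => j _.
  by rewrite linearZ.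
apply: continuous_big => [|j _]; first exact: add_continuous.
move=> x; apply: continuousM; [exact: coord_continuous|exact: cst_continuous].
Qed.

(* The fourth hypothesis says that [K] is an intersection of closed half-spaces;
   in this form closedness is checked one linear functional at a time. *)
Lemma linear_fractional_min {R : realType} (n : nat) (K : 'rV[R]_n -> Prop)
    (f p : 'rV[R]_n -> R) :
  scalar f -> scalar p -> (exists x, K x) ->
  (forall x, (forall (L : 'rV[R]_n -> R) (c : R), scalar L ->
     (forall y, K y -> c <= L y) -> c <= L x) -> K x) ->
  (forall x j, K x -> `|x 0 j| <= 1) ->
  (forall x, K x -> 0 < p x) ->
  exists2 x, K x & forall y, K y -> f x / p x <= f y / p y.
Proof.
move=> flin plin K0 K_closed K_bounded p_gt0.
pose A : set 'rV[R]_n := fun x => K x.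
pose I1 : set R := [set` `[(-1 : R), 1]%R]%classic.
pose B := [set x : 'rV[R]_n | forall j, I1 (x ord0 j)]%classic.
pose H (Lc : ('rV[R]_n -> R) * R) := (Lc.1 @^-1` [set y | Lc.2 <= y])%classic.
pose D := [set Lc : ('rV[R]_n -> R) * R | scalar Lc.1 /\
  forall y, K y -> Lc.2 <= Lc.1 y]%classic.
(* [K] is the unit box cut by all closed half-spaces containing [K], hence compact. *)
have AE : A = (B `&` \bigcap_(Lc in D) H Lc)%classic.
  apply/seteqP; split=> x /=.
    move=> Kx; split=> [j|Lc [_]]; last exact.
    by have := K_bounded x j Kx; rewrite /I1/= in_itv/= ler_norml.
  move=> [_ Hx]; apply: K_closed => L c Llin Lc.
  exact: (Hx (L, c)).
have cA : compact A.
  rewrite AE; apply: compact_closedI.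
    apply: (@rV_compact R n (fun=> I1)) => _.
    exact: segment_compact.
  apply: closed_bigI => -[L c] [Llin _]; apply: preimage_closed.
    by move=> x _; exact: scalar_continuous.
  exact: closed_ge.
have cfp : {within A, continuous (fun x => f x / p x)}%classic.
  apply: continuous_in_subspaceT => x /set_mem Kx.
  apply: (@continuousM R _ f (fun x => (p x)^-1)).
    exact: scalar_continuous.
  apply: continuousV; last exact: scalar_continuous.
  by rewrite gt_eqF// p_gt0.
have [x xA xmin] := compact_EVT_min K0 cA cfp.
exists x; first exact: set_mem xA.
by move=> y Ky; apply: xmin; exact: mem_set.
Qed.

(** * Real coordinates for complex matrices *)

Section coordinates.
Context {R : realType} {D : nat}.

Let index : finType := (bool * ('I_D * 'I_D))%type.

Definition of_coords (x : 'rV[R]_#|index|) : 'M[R[i]]_D :=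
  \matrix_(a, b) (x 0 (enum_rank (false, (a, b)) : 'I_#|index|) +i*
                  x 0 (enum_rank (true, (a, b)) : 'I_#|index|)).

Definition to_coords (A : 'M[R[i]]_D) : 'rV[R]_#|index| :=
  \row_j let: (t, (a, b)) := enum_val j in
    if t then complex.Im (A a b) else complex.Re (A a b).

Lemma to_coordsK : cancel to_coords of_coords.
Proof.
move=> A; apply/matrixP => a b; rewrite !mxE !enum_rankK.
by case: (A a b).
Qed.

Lemma of_coords_linear (a : R) (x y : 'rV[R]_#|index|) :
  of_coords (a *: x + y) = a%:C *: of_coords x + of_coords y.
Proof.
apply/matrixP => i j; rewrite !mxE.
by apply/eqP; rewrite eq_complex/= !mul0r subr0 addr0 !eqxx.
Qed.

Lemma coord_of_coords (x : 'rV[R]_#|index|) j : exists a b,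
  x 0 j = complex.Re (of_coords x a b) \/
  x 0 j = complex.Im (of_coords x a b).
Proof.
rewrite -(enum_valK j); case: (enum_val j) => -[] [a b]; exists a, b.
  by right; rewrite mxE.
by left; rewrite mxE.
Qed.

End coordinates.

(** Positivity at [e_a + c e_b] gives [2 Re (c A_ab) >= - A_aa - A_bb >= -2] when [c] has modulus 1;
    the choices 1, -1, i, -i bound both parts. *)
Lemma psd_entry_le1 {R : realType} (D : nat) (A : 'M[R[i]]_D) (a b : 'I_D) :
  density A ->
  `|complex.Re (A a b)| <= 1 /\ `|complex.Im (A a b)| <= 1.
Proof.
move=> [[/hermsymmxP Aadj A0] tr1].
have Aba : A b a = (A a b)^* by rewrite -[in LHS]Aadj !mxE.
pose v c : 'cV[R[i]]_D := delta_mx a 0 + c *: delta_mx b 0.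
have diag_ge0 x : 0 <= A x x.
  have := A0 (delta_mx x 0).
  by rewrite trmx_delta map_delta_mx -rowE -colE !mxE.
have diag_le1 x : A x x <= 1.
  by rewrite -tr1 /mxtrace (bigD1 x)//= lerDl sumr_ge0.
have form c : ((v c)^t* *m A *m v c) 0 0 =
    A a a + c * A a b + (c * A a b)^* + c^* * c * A b b.
  have -> : (v c)^t* = delta_mx 0 a + c^* *: delta_mx 0 b.
    apply/matrixP => x y; rewrite [x]ord1 !mxE rmorphD rmorphM !rmorph_nat.
    by rewrite eqxx !andbT.
  rewrite /v !mulmxDr !mulmxDl -!scalemxAl -!scalemxAr.
  rewrite -!rowE -!colE !mxE Aba rmorphM; ring.
have key c : c^* * c = 1 -> -1 <= complex.Re (c * A a b).
  move=> c1; have := A0 (v c); rewrite form c1 mul1r.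
  have := diag_le1 a; have := diag_le1 b.
  case: (c * A a b) (A a a) (A b b) => [z1 z2] [x1 x2] [y1 y2].
  rewrite !lecE/= => /andP[_ h1] /andP[_ h2] /andP[_ h3]; lra.
have norm1 (x y : R) : x ^+ 2 + y ^+ 2 = 1 -> (x +i* y)^* * (x +i* y) = 1.
  by move=> xy; rewrite -normCKC normc_def/= xy sqrtr1 expr1n.
have k1 := key _ (norm1 1 0 ltac:(ring)).
have k2 := key _ (norm1 (- 1) 0 ltac:(ring)).
have k3 := key _ (norm1 0 1 ltac:(ring)).
have k4 := key _ (norm1 0 (- 1) ltac:(ring)).
move: k1 k2 k3 k4; case: (A a b) => x y /=.
rewrite !ler_norml !mul0r !mul1r !subr0 !sub0r !mulN1r.
by move=> k1 k2 k3 k4; split; apply/andP; split; lra.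
Qed.

(** In real coordinates the feasible states form a bounded intersection of half-spaces, and the
    conditional fidelity is a ratio of linear functionals with denominator at least [delta]. *)
Lemma feasible_min {R : realType} (q N k : nat) (G : 'cV[R[i]]_q)
    (lam delta : R) : 0 < delta ->
  (exists F, feasible_fids G lam k N delta F) ->
  feasible_fids G lam k N delta (minimum (feasible_fids G lam k N delta)).
Proof.
move=> d0 [F0 [rho0 [rho0D rho0P rho0p _]]].
set S := feasible_fids G lam k N delta.
(* Once a least element exists, [xget] returns one instead of its default. *)
suff [F SF lbF] : exists2 F, S F & forall F', S F' -> F <= F'.
  by have [] := @xgetPex R 0 (S `&` lbound S)%classic (ex_intro _ F (conj SF lbF)).
set D := tdim 'I_N.+1 q in rho0 rho0D rho0P rho0p *.
pose feasible (rho : 'M[R[i]]_D) :=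
  [/\ density rho, perm_invariant rho & delta <= pass_prob G lam k rho].
pose K x := feasible (of_coords x).
have sumlin (T : nat -> 'M[R[i]]_D) : scalar (fun x =>
    complex.Re (\sum_(i < k.+1) 'C(N, i)%:R * \tr (T i *m of_coords x))).
  move=> a x y; rewrite of_coords_linear -Re_realM.
  rewrite mulr_sumr !Re_sum -big_split/=; apply: eq_bigr => i _.
  rewrite mulmxDr mxtraceD -scalemxAr mxtraceZ mulrDr mulrCA.
  exact: ReD.
have flin : scalar (fun x => pass_fid (N := N) G lam k (of_coords x)).
  exact: (sumlin (fun i => test_op G lam N i (ketbra G))).
have plin : scalar (fun x => pass_prob (N := N) G lam k (of_coords x)).
  exact: (sumlin (fun i => test_op G lam N i 1%:M)).
have [|x Lx|x j|x|x Kx xmin] :=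
    @linear_fractional_min R _ K _ _ flin plin.
- by exists (to_coords rho0); rewrite /K to_coordsK.
(* Linearity is required over real scalars only, because conjugate transposition is not complex
   linear. *)
- pose cplx_lin (phi : 'M[R[i]]_D -> R[i]) :=
    forall a A B, phi (a%:C *: A + B) = a%:C * phi A + phi B.
  have Re_lin phi : cplx_lin phi ->
      scalar (fun x => complex.Re (phi (of_coords x))).
    move=> lin a y z; rewrite of_coords_linear lin -Re_realM.
    exact: ReD.
  (* An equality is a pair of opposite inequalities, each cutting out a half-space. *)
  have Re_eq phi (z : R[i]) : cplx_lin phi ->
      (forall rho, feasible rho -> phi rho = z) ->
      complex.Re (phi (of_coords x)) = complex.Re z.
    move=> lin phiE; apply/eqP; rewrite eq_le -lerN2; apply/andP; split.
      apply: (Lx (fun x => - complex.Re (phi (of_coords x)))) => [a y y'|y Ky].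
        by rewrite (Re_lin _ lin) opprD mulrN.
      by rewrite phiE.
    apply: (Lx (fun x => complex.Re (phi (of_coords x)))) => [|y Ky].
      exact: Re_lin.
    by rewrite phiE.
  have cplx_eq phi z : cplx_lin phi ->
      (forall rho, feasible rho -> phi rho = z) -> phi (of_coords x) = z.
    move=> lin phiE; have reE := Re_eq _ _ lin phiE.
    (* Multiplication by [-i] turns the imaginary part into a real part. *)
    have imE : complex.Re ((0 +i* -1) * phi (of_coords x)) =
        complex.Re ((0 +i* -1) * z).
      apply: (Re_eq (fun A => (0 +i* -1) * phi A)) => [a A B|rho rhoK].
        by rewrite lin mulrDr mulrCA.
      by rewrite phiE.
    move: reE imE; case: (phi _) z {phiE} => [x1 x2] [z1 z2] /= -> imE.
    by congr (_ +i* _); move: imE; rewrite !mul0r !mulN1r !opprK !add0r.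
  have rhoadj : (of_coords x)^t* = of_coords x.
    apply/matrixP => a b.
    have := cplx_eq (fun A => (A^t*) a b - A a b) 0.
    rewrite /= => E; apply/eqP; rewrite -subr_eq0; apply/eqP.
    apply: E => [c A B|rho [[[/hermsymmxP -> _] _] _ _]]; last by rewrite subrr.
    have conjE (z w : R[i]) :
        Num.conj (c%:C * z + w) = c%:C * Num.conj z + Num.conj w.
      rewrite rmorphD rmorphM; congr (_ * _ + _); exact: conjc_real.
    by rewrite !mxE conjE; ring.
  have formlin v : cplx_lin (fun A => (v^t* *m A *m v) 0 0).
    move=> c A B; rewrite mulmxDr mulmxDl -scalemxAr -scalemxAl.
    by rewrite !mxE.
  split; first split.
  + split; first exact/hermsymmxP.
    move=> v; rewrite lecE/=; apply/andP; split.
      set z := (_ *m _ *m _) 0 0.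
      (* Half-spaces control only the real part of the form; its imaginary part vanishes because
         [of_coords x] is Hermitian. *)
      have : z^* = z.
        transitivity ((v^t* *m of_coords x *m v)^t* 0 0).
          by rewrite [RHS]mxE [in RHS]mxE.
        by rewrite !adjmxM adjmxK rhoadj mulmxA.
      by case: z => z1 z2 []/= z2E; apply/eqP; lra.
    apply: (Lx (fun x => complex.Re ((v^t* *m of_coords x *m v) 0 0))).
      exact: (Re_lin (fun A => (v^t* *m A *m v) 0 0)).
    move=> y [[[_ /(_ v)]]]; rewrite lecE/= => /andP[_].
    by [].
  + apply: (cplx_eq (fun A => \tr A)) => [c A B|rho [[]]//].
    by rewrite mxtraceD mxtraceZ.
  + move=> sigma; apply/matrixP => a b; apply/eqP; rewrite -subr_eq0; apply/eqP.
    apply: (cplx_eq (fun A => (perm_op R q sigma *m A *m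
      (perm_op R q sigma)^t*) a b - A a b)) => [c A B|rho [_ -> _]].
      rewrite mulmxDr mulmxDl -scalemxAr -scalemxAl !mxE; ring.
    by rewrite subrr.
  + by apply: (Lx _ _ plin) => y [].
- move=> [rhoD _ _]; have [a [b [->|->]]] := coord_of_coords x j.
    by have [] := psd_entry_le1 _ _ a b rhoD.
  by have [] := psd_entry_le1 _ _ a b rhoD.
- by move=> [_ _]; exact: lt_le_trans.
exists (cond_fid G lam k (of_coords x)).
  by case: Kx => *; exists (of_coords x).
move=> _ [rho [rhoD rhoP rhop ->]].
have := xmin (to_coords rho); rewrite /K to_coordsK; apply.
by split.
Qed.

(** * Feasibility of the ideal state and the final bound *)

Lemma bin_cdf_ge0 {R : realType} (lam nu : R) (j k : nat) :
  0 <= lam -> 0 <= nu -> 0 <= bin_cdf lam nu j k.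
Proof. by move=> l0 n0; apply: sumr_ge0 => i _; exact: bin_pmf_ge0. Qed.

Lemma bin_cdf0 {R : realType} (lam nu : R) (k : nat) : bin_cdf lam nu 0 k = 1.
Proof.
rewrite /bin_cdf big_ord_recl big1 ?addr0 => [|i _].
  by rewrite /bin_pmf bin0 !expr0 !mulr1.
by rewrite /bin_pmf bin0n /= !mul0r.
Qed.

(** Copies of the target lie in the sector of the empty set, where no test fails, so they pass with
    probability at least [1 >= delta]. This makes the feasible set nonempty, as [feasible_min]
    requires. *)
Lemma ideal_state_feasible {R : realType} (q N k : nat) (G : 'cV[R[i]]_q)
    (lam delta : R) :
  G^t* *m G = 1%:M -> 0 <= lam <= 1 -> delta <= 1 ->
  exists F, feasible_fids G lam k N delta F.
Proof.
move=> G1 /andP[lam0 lam1] d1.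
pose rho : 'M[R[i]]_(tdim 'I_N.+1 q) := tensor_op (fun=> ketbra G).
have rhoE : rho = sector_op G (set0 : {set 'I_N.+1}).
  by apply: eq_tensor_op => j; rewrite inE.
have rho_adj : rho^t* = rho by rewrite rhoE sector_op_adj.
have rhoM : rho *m rho = rho by rewrite rhoE sector_opM.
have tr1 : \tr rho = 1.
  by rewrite mxtrace_tensor_op big1// => j _; rewrite mxtrace_ketbra.
have rho0 : psd rho.
  split=> [|v]; first exact/hermsymmxP.
  by rewrite -rhoM -{1}rho_adj mulmxA -adjmxM -mulmxA normsq_mx_ge0.
have rhoP : perm_invariant rho by move=> s; rewrite perm_op_conj.
exists (cond_fid G lam k rho), rho; split=> //.
apply: (le_trans d1); rewrite (pass_probE G lam (1 - lam) N erefl)//.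
have cdf0 := bin_cdf_ge0 lam (1 - lam) _ k lam0.
rewrite (bigD1 set0)//= set0D cards0 bin_cdf0 mul1r.
rewrite {1}/sector_prob -rhoE rhoM tr1 lerDl sumr_ge0// => S _.
by rewrite mulr_ge0 ?sector_prob_ge0// cdf0// subr_ge0.
Qed.

Theorem theorem2 (R : realType) (d n : nat) (hd : prime d) (hn : (0 < n)%N)
    (E : {set 'I_n * 'I_n}) (hE : edge_set E) (m : 'I_n * 'I_n -> 'I_d)
    (lambda nu s epsilon delta : R) (N : nat)
    (hlambda : 0 < lambda < 1) (hnu : nu = 1 - lambda)
    (hs : 0 <= s) (hse : s < epsilon) (hepsilon : epsilon < 1)
    (hdelta : 0 < delta <= 2^-1) (hN : (0 < N)%N)
    (hNbound : epsilon / (lambda * nu * (epsilon - s)) ^+ 2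
                 * (ln (delta^-1) + 4 * lambda * nu ^+ 2) <= N%:R) :
  guaranteed_infidelity (graph_state R E m) lambda
    (Num.truncn (nu * s * N%:R)) N delta <= epsilon.
Proof.
have G1 := @graph_state_unit R d n E m (prime_gt0 hd).
have /andP[d0 d12] := hdelta.
have /andP[l0 l1] := hlambda.
have lam01 : 0 <= lambda <= 1 by rewrite !ltW.
have d1 : delta <= 1 by lra.
set k := Num.truncn _.
(* Truncation is the floor here, its argument being nonnegative. *)
have hk : k%:R <= nu * s * N%:R.
  by rewrite truncn_le// mulr_ge0// mulr_ge0// hnu subr_ge0 ltW.
have [F feasF] := ideal_state_feasible _ N k _ lambda delta G1 lam01 d1.
have [rho [rhoD rhoP rhop minE]] :=
  feasible_min _ N k _ lambda delta d0 (ex_intro _ F feasF).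
rewrite /guaranteed_infidelity minE lerBlDl -lerBlDr.
exact: (cond_fid_ge _ G1 lambda nu N hnu rho s epsilon delta k).
Qed.
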